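(* Let $n,p$ be positive integers, $\sigma>0$, $\mu\in\mathbb{R}^n$, and let $\mathbb{X}$ be any real (deterministic) matrix of size $n\times p$. Let $y=\mu+\xi$, where the random vector $\xi$ in $\mathbb{R}^n$ satisfies $\mathbb{E}[\exp(v^T\xi)]\le \exp(\sigma^2|v|_2^2/2)$ for all $v\in\mathbb{R}^n$. Let $(\hat\beta_j)_{j\in\hat J}$ be a nonempty family of estimators valued in $\mathbb{R}^p$, where both the cardinality of the family and its elements can depend on the data $y$. Let $\hat\sigma^2\ge0$ be any real-valued estimator and let $\delta=\mathbb{P}(\hat\sigma^2<\sigma^2)$. Define $\hat F=\{\mathrm{supp}(\hat\beta_j):\ j\in\hat J\}$ and let $\hat\mu^Q$ be the estimator built from $\hat F$ and $\hat\sigma^2$ defined in the context. Then for all $x>0$, with probability greater than $1-\delta-2\exp(-x)$, $$\|\hat\mu^{Q}-\mu\|^2\le \inf_{j\in\hat J}\left(\|\mathbb{X}\hat\beta_j-\mu\|^2+\frac{\hat\sigma^2}{n}\left(24+96|\hat\beta_j|_0\log\left(\frac{ep}{|\hat\beta_j|_0\vee 1}\right)\right)\right)+\frac{22\sigma^2x}{n}.$$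
   Context: Notation: $|\cdot|_2$ is the Euclidean norm on $\mathbb{R}^n$, $\|u\|^2=\frac1n|u|_2^2$ for $u\in\mathbb{R}^n$, $a\vee b=\max(a,b)$; for $\beta\in\mathbb{R}^p$, $\mathrm{supp}(\beta)=\{k:\beta_k\neq0\}$ and $|\beta|_0$ is the number of nonzero coefficients of $\beta$. ''Estimator'' and ''data-driven'' mean depending (measurably) on $y$. No relation between $\mu$ and $\mathbb{X}$ is assumed. A support is a subset $T\subset\{1,\dots,p\}$; $|T|$ is its cardinality and $\Pi_T\in\mathbb{R}^{n\times n}$ is the orthogonal projection onto the linear span of the columns of $\mathbb{X}$ with indices in $T$. Weights: for every support $T$, $$\pi_T=\left(H_p\binom{p}{|T|}e^{|T|}\right)^{-1},\qquad H_p=\frac{e-e^{-p}}{e-1}.$$ Estimator $\hat\mu^Q$: let $\hat M$ be the cardinality of $\hat F$, write $\hat F=\{\hat T_1,\dots,\hat T_{\hat M}\}$, $\hat\mu_j=\Pi_{\hat T_j}y$, and $\hat\mu_\theta=\sum_{j=1}^{\hat M}\theta_j\hat\mu_j$ for $\theta\in\mathbb{R}^{\hat M}$. Let $\Lambda^{\hat M}=\{\theta\in\mathbb{R}^{\hat M}:\ \sum_j\theta_j=1,\ \theta_j\ge0\ \forall j\}$ and, for $\theta\in\Lambda^{\hat M}$, $$H(\theta)=|\hat\mu_\theta-y|_2^2+\frac12\sum_{j=1}^{\hat M}\theta_j|\hat\mu_j-\hat\mu_\theta|_2^2+26\hat\sigma^2\sum_{j=1}^{\hat M}\theta_j\log\frac1{\pi_{\hat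 T_j}}.$$ Then $\hat\mu^Q=\hat\mu_{\hat\theta}$, where $\hat\theta$ is any minimizer of $H$ over $\Lambda^{\hat M}$. *)

(* Defs.v *)
From HB Require Import structures.
From mathcomp Require Import all_boot all_order all_algebra.
From mathcomp Require Import all_classical all_reals all_analysis.

Set Implicit Arguments.
Unset Strict Implicit.
Unset Printing Implicit Defensive.

Import Order.TTheory GRing.Theory Num.Theory.
Import numFieldNormedType.Exports.

Local Open Scope classical_set_scope.
Local Open Scope ring_scope.

(* Column vectors carry the product (= Borel) sigma-algebra, generated by the
   coordinates, exactly as n.-tuple does in the library. *)
Definition measure_colvec_display : measure_display -> measure_display.
Proof. exact. Qed.

Section measurable_colvec.
Context {d} {R : measurableType d}.
Variable n : nat.

Let coors : 'I_n -> 'cV[R]_n -> R := fun i u => u i 0.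

Let colvec_set0 : g_sigma_preimage coors set0.
Proof. exact: sigma_algebra0. Qed.

Let colvec_setC A : g_sigma_preimage coors A -> g_sigma_preimage coors (~` A).
Proof. exact: sigma_algebraC. Qed.

Let colvec_bigcup (F : _^nat) : (forall i, g_sigma_preimage coors (F i)) ->
  g_sigma_preimage coors (\bigcup_i (F i)).
Proof. exact: sigma_algebra_bigcup. Qed.

HB.instance Definition _ := @isMeasurable.Build (measure_colvec_display d)
  'cV[R]_n (g_sigma_preimage coors) colvec_set0 colvec_setC colvec_bigcup.

End measurable_colvec.

(* When E is measurable this says c < P E (lemma prob_gtE); the measurable
   witness gives it a meaning for events that need not be measurable, such as
   those involving an infimum over an uncountable family of estimators. *)
Definition prob_gt {d} {T : measurableType d} {R : realType}
    (P : probability T R) (c : \bar R) (E : set T) : Prop :=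
  exists A : set T, [/\ measurable A, A `<=` E & (c < P A)%E].

Lemma prob_gtE {d} {T : measurableType d} {R : realType}
    (P : probability T R) (c : \bar R) (E : set T) :
  measurable E -> prob_gt P c E <-> (c < P E)%E.
Proof.
move=> mE; split => [[A [mA AE cA]]|cE]; last by exists E; split => //; exact: subset_refl.
by apply: (lt_le_trans cA); apply: le_measure AE; rewrite inE.
Qed.

Section aggregation.
Context {R : realType}.

Definition l2norm n (u : 'cV[R]_n) : R := Num.sqrt (\sum_i u i 0 ^+ 2).

(* ||u||^2 = |u|_2^2 / n *)
Definition scaled_sqnorm n (u : 'cV[R]_n) : R := n%:R^-1 * l2norm u ^+ 2.

Definition supp p (b : 'cV[R]_p) : {set 'I_p} := [set k | b k 0 != 0].

(* The span of the columns of X with indices in T, as a row space. *)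
Definition colspan n p (X : 'M[R]_(n, p)) (T : {set 'I_p}) : 'M[R]_n :=
  (\sum_(k in T) <<(col k X)^T>>)%MS.

(* kermx U^T is the orthogonal complement of the row space of U; the final
   transposition makes the projection act on column vectors. *)
Definition orthproj n p (X : 'M[R]_(n, p)) (T : {set 'I_p}) : 'M[R]_n :=
  (proj_mx (colspan X T) (kermx (colspan X T)^T))^T.

Lemma cap_ker_tr n (U : 'M[R]_n) : (U :&: kermx U^T = 0)%MS.
Proof.
apply/eqP; apply: contraT => /rowV0Pn[v].
rewrite sub_capmx => /andP[/submxP[w vE] /sub_kermxP vU] /negP[].
have vv : v *m v^T = 0 by rewrite {2}vE trmx_mul mulmxA vU mul0mx.
apply/eqP/rowP => j; rewrite mxE.
have /eqP : (v *m v^T) 0 0 = 0 by rewrite vv mxE.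
rewrite mxE psumr_eq0 => [|i _]; last by rewrite mxE -expr2 sqr_ge0.
by move=> /allP/(_ j (mem_index_enum _)); rewrite mxE -expr2 sqrf_eq0 => /eqP.
Qed.

Lemma add_ker_tr n (U : 'M[R]_n) : (1%:M <= U + kermx U^T)%MS.
Proof.
have /mxdirect_addsP/mxdirectP /= rk := cap_ker_tr U.
by rewrite sub1mx /row_full rk mxrank_ker mxrank_tr subnKC ?rank_leq_col.
Qed.

Lemma orthproj_in n p (X : 'M[R]_(n, p)) (T : {set 'I_p}) (u : 'cV[R]_n) :
  ((orthproj X T *m u)^T <= colspan X T)%MS.
Proof. by rewrite trmx_mul trmxK proj_mx_sub. Qed.

Lemma orthproj_ortho n p (X : 'M[R]_(n, p)) (T : {set 'I_p}) (u : 'cV[R]_n)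
    (k : 'I_p) : k \in T -> (u - orthproj X T *m u)^T *m col k X = 0.
Proof.
move=> kT; rewrite linearB /= trmx_mul trmxK.
have /sub_kermxP : (u^T - u^T *m proj_mx (colspan X T) (kermx (colspan X T)^T)
    <= kermx (colspan X T)^T)%MS.
  by apply: proj_mx_compl_sub; rewrite (submx_trans (submx1 _)) ?add_ker_tr.
have /submxP[w wE] : ((col k X)^T <= colspan X T)%MS.
  by rewrite /colspan (sumsmx_sup k) // genmxE.
by move=> h; rewrite -[col k X]trmxK wE trmx_mul mulmxA h mul0mx.
Qed.

Definition weight p (T : {set 'I_p}) : R :=
  ((expR 1 - expR (- p%:R)) / (expR 1 - 1)
     * 'C(p, #|T|)%:R * expR #|T|%:R)^-1.

Section aggregate.
Variables (n p : nat) (X : 'M[R]_(n, p)) (y : 'cV[R]_n).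
Variables (s2 : R) (F : {set {set 'I_p}}).

(* The supports in F are enumerated by enum_val : 'I_#|F| -> {set 'I_p}. *)
Definition muhat (j : 'I_#|F|) : 'cV[R]_n := orthproj X (enum_val j) *m y.

Definition muhat_mix (th : 'rV[R]_#|F|) : 'cV[R]_n :=
  \sum_j th 0 j *: muhat j.

Definition simplex (th : 'rV[R]_#|F|) : Prop :=
  \sum_j th 0 j = 1 /\ forall j, 0 <= th 0 j.

Definition Hcrit (th : 'rV[R]_#|F|) : R :=
  l2norm (muhat_mix th - y) ^+ 2
  + 2^-1 * \sum_j th 0 j * l2norm (muhat j - muhat_mix th) ^+ 2
  + 26 * s2 * \sum_j th 0 j * ln (1 / weight (enum_val j)).

Definition Hminimizer (th : 'rV[R]_#|F|) : Prop :=
  simplex th /\ forall th', simplex th' -> Hcrit th <= Hcrit th'.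

End aggregate.

(* A data-driven family is given by an index type I, the data-dependent set
   J y of active indices, and the estimators bhat j, used only where J y j. *)
Definition supports n p (I : Type) (J : 'cV[R]_n -> set I)
    (bhat : I -> 'cV[R]_n -> 'cV[R]_p) (y : 'cV[R]_n) : {set {set 'I_p}} :=
  [set T | `[< exists2 j, J y j & supp (bhat j y) = T >]].

End aggregation.

(* Main.v *)
Require Import Defs.
From HB Require Import structures.
From mathcomp Require Import all_boot all_order all_algebra.
From mathcomp Require Import all_classical all_reals all_analysis.
From mathcomp Require Import measurable_realfun ring lra.

(** Convexity gives first-order optimality of the weights [th]; expanding it, the
    risk of the aggregate exceeds the risk of [mu_T = Pi_T y] plus its penalty by
    at most the [th]-average over [S] of
      2 <xi, mu_S - mu_T> - |mu_S - mu_T|^2 / 2 - penalty S.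
    Both this noise term and the excess |Pi_T xi|^2 of the risk of [mu_T] over
    that of any point of the span of [T] are controlled by |Q xi|^2, where [Q]
    projects on the span of the columns in the union of [S] and [T]. A Gaussian
    mixture bounds the exponential moments of |Q xi|^2, and a union bound over the
    pairs (S, T), with probabilities weight S * weight T * exp (- x), costs only
    exp (- x) in total since the weights sum to one. *)

Set Implicit Arguments.
Unset Strict Implicit.
Unset Printing Implicit Defensive.

Import Order.TTheory GRing.Theory Num.Theory.
Import numFieldNormedType.Exports.

Local Open Scope classical_set_scope.
Local Open Scope ring_scope.

(** * Inner product, orthonormal sequences and Gram-Schmidt *)

Section dot_product.
Context {R : realType} {n : nat}.
Implicit Types (u v w : 'cV[R]_n) (s : seq 'cV[R]_n).

Definition dot u v : R := (u^T *m v) 0 0.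

Lemma dotE u v : dot u v = \sum_i u i 0 * v i 0.
Proof. by rewrite /dot mxE; apply: eq_bigr => i _; rewrite mxE. Qed.

Lemma dotC u v : dot u v = dot v u.
Proof. by rewrite !dotE; apply: eq_bigr => i _; rewrite mulrC. Qed.

Lemma dotDr u v w : dot u (v + w) = dot u v + dot u w.
Proof. by rewrite /dot mulmxDr mxE. Qed.

Lemma dotZr a u v : dot u (a *: v) = a * dot u v.
Proof. by rewrite /dot -scalemxAr mxE. Qed.

Lemma dotNr u v : dot u (- v) = - dot u v.
Proof. by rewrite /dot mulmxN mxE. Qed.

Lemma dot0r u : dot u 0 = 0.
Proof. by rewrite /dot mulmx0 mxE. Qed.

Lemma dotDl u v w : dot (u + v) w = dot u w + dot v w.
Proof. by rewrite dotC dotDr !(dotC w). Qed.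

Lemma dotZl a u v : dot (a *: u) v = a * dot u v.
Proof. by rewrite dotC dotZr dotC. Qed.

Lemma dotNl u v : dot (- u) v = - dot u v.
Proof. by rewrite dotC dotNr dotC. Qed.

Lemma dot_sumr I (r : seq I) (P : pred I) (F : I -> 'cV[R]_n) u :
  dot u (\sum_(i <- r | P i) F i) = \sum_(i <- r | P i) dot u (F i).
Proof. by rewrite /dot mulmx_sumr summxE. Qed.

Lemma dot_suml I (r : seq I) (P : pred I) (F : I -> 'cV[R]_n) u :
  dot (\sum_(i <- r | P i) F i) u = \sum_(i <- r | P i) dot (F i) u.
Proof. by rewrite dotC dot_sumr; apply: eq_bigr => i _; rewrite dotC. Qed.

Definition dotlin := (dotDr, dotDl, dotNr, dotNl, dotZr, dotZl).

Lemma dot_ge0 u : 0 <= dot u u.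
Proof. by rewrite dotE sumr_ge0// => i _; rewrite -expr2 sqr_ge0. Qed.

Lemma dot_eq0 u : dot u u = 0 -> u = 0.
Proof.
move=> u0; apply/colP => i; rewrite mxE; apply/eqP.
rewrite -sqrf_eq0 expr2; apply/eqP; move: u0; rewrite dotE => /psumr_eq0P.
by apply=> // j _; rewrite -expr2 sqr_ge0.
Qed.

Lemma sqr_l2norm u : l2norm u ^+ 2 = dot u u.
Proof.
by rewrite /l2norm sqr_sqrtr ?dotE// sumr_ge0// => i _; rewrite sqr_ge0.
Qed.

(** Recursive form, so that an induction on [s] peels off one vector at a time; orthogonality to the
    later vectors suffices by symmetry. *)
Fixpoint orthonormal_seq s : Prop :=
  if s is u :: s' then
    [/\ dot u u = 1, forall v, v \in s' -> dot u v = 0 & orthonormal_seq s']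
  else True.

(** For orthonormal [s], the orthogonal projection onto its span; its squared norm is then a sum of
    squared linear forms ([dot_oprojE]), the shape the moment bound handles. *)
Definition oproj s v := \sum_(u <- s) dot u v *: u.

Lemma dot_oproj_ortho s v w :
  (forall u, u \in s -> dot w u = 0) -> dot w (oproj s v) = 0.
Proof.
by move=> ws; rewrite dot_sumr big_seq big1// => u us; rewrite dotZr ws// mulr0.
Qed.

Lemma dot_oproj s v u : orthonormal_seq s -> u \in s ->
  dot u (oproj s v) = dot u v.
Proof.
elim: s => [//|a s IH] /= [aa as0 os]; rewrite /oproj big_cons dotDr dotZr.
rewrite inE => /predU1P[->|us]; first by rewrite aa dot_oproj_ortho// mulr1 addr0.
by rewrite IH// (dotC u a) (as0 u)// mulr0 add0r.
Qed.

(** The residual [r] of a new vector [a] is either zero, and [s] already reproduces [a], or it is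
    normalised and put in front. The earlier vectors of [c] are fixed by [oproj s], hence orthogonal
    to [r], and stay fixed. *)
Lemma gram_schmidt (c : seq 'cV[R]_n) :
  exists s, [/\ (size s <= size c)%N, orthonormal_seq s
    & forall a, a \in c -> oproj s a = a].
Proof.
elim: c => [|a c [s [sc os cs]]]; first by exists [::].
have [r rE] : exists r, r = a - oproj s a by exists (a - oproj s a).
have rs u : u \in s -> dot u r = 0.
  by move=> us; rewrite rE dotDr dotNr dot_oproj// subrr.
have [r0|r0] := eqVneq (dot r r) 0.
  exists s; split => //; first exact: leqW.
  move=> b; rewrite inE => /predU1P[->|]; last exact: cs.
  by apply/esym/eqP; rewrite -subr_eq0 -rE; apply/eqP/dot_eq0.
have r_gt0 : 0 < dot r r by rewrite lt_neqAle eq_sym r0 dot_ge0.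
set k := Num.sqrt (dot r r).
have kk : k * k = dot r r by rewrite -expr2 sqr_sqrtr// dot_ge0.
have k0 : k != 0 by rewrite gt_eqF// sqrtr_gt0.
have rs' b : b \in c -> dot r b = 0.
  move=> bc; rewrite -(cs _ bc) dot_oproj_ortho// => u us.
  by rewrite dotC rs.
exists (k^-1 *: r :: s); split => //=.
- split => //; first by rewrite dotZl dotZr -kk; field.
  by move=> v vs; rewrite dotZl dotC rs// mulr0.
- move=> b; rewrite inE /oproj big_cons => /predU1P[->|bc].
    rewrite -/(oproj s a) scalerA dotZl.
    have -> : dot r a = k * k.
      have : dot r (oproj s a) = 0.
        by rewrite dot_oproj_ortho// => u us; rewrite dotC rs.
      by move=> e; rewrite kk {3}rE dotDr dotNr e subr0.
    have -> : k^-1 * (k * k) / k = 1 by field.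
    by rewrite scale1r rE subrK.
  by rewrite dotZl rs'// mulr0 scale0r add0r -/(oproj s b) cs.
Qed.

Lemma oproj_sum I (r : seq I) (P : pred I) (F : I -> 'cV[R]_n) s :
  oproj s (\sum_(i <- r | P i) F i) = \sum_(i <- r | P i) oproj s (F i).
Proof.
rewrite /oproj exchange_big/=; apply: eq_bigr => u _.
by rewrite dot_sumr scaler_suml.
Qed.

Lemma oprojZ a v s : oproj s (a *: v) = a *: oproj s v.
Proof.
by rewrite /oproj scaler_sumr; apply: eq_bigr => u _; rewrite dotZr scalerA.
Qed.

Lemma oprojB v w s : oproj s (v - w) = oproj s v - oproj s w.
Proof.
rewrite /oproj -sumrB; apply: eq_bigr => u _.
by rewrite dotDr dotNr scalerBl.
Qed.

Lemma oproj_sym s v w : dot (oproj s v) w = dot v (oproj s w).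
Proof.
rewrite dot_suml dot_sumr; apply: eq_bigr => u _.
by rewrite !dotlin mulrC (dotC v) mulrC.
Qed.

Lemma oproj_idem s v : orthonormal_seq s -> oproj s (oproj s v) = oproj s v.
Proof.
move=> os; rewrite {1 3}/oproj big_seq [in RHS]big_seq.
by apply: eq_bigr => u us; rewrite dot_oproj.
Qed.

Lemma dot_oprojE s v : orthonormal_seq s ->
  dot (oproj s v) (oproj s v) = \sum_(u <- s) dot u v ^+ 2.
Proof.
move=> os; rewrite oproj_sym oproj_idem// dot_sumr.
by apply: eq_bigr => u _; rewrite !dotlin (dotC v) expr2.
Qed.

(* Complete the square in [b], using [dot e b = dot (oproj s e) b]. *)
Lemma dot_le_oproj s (a : R) e b : 0 < a -> orthonormal_seq s -> oproj s b = b ->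
  2 * dot e b - a * dot b b <= a^-1 * dot (oproj s e) (oproj s e).
Proof.
move=> a0 os sb.
have : 0 <= a * dot (b - a^-1 *: oproj s e) (b - a^-1 *: oproj s e).
  by rewrite mulr_ge0 ?dot_ge0// ltW.
rewrite !dotlin (dotC b) oproj_sym sb; set x := dot _ (oproj _ _) => h.
rewrite -subr_ge0; apply: le_trans h _; rewrite le_eqVlt; apply/orP; left.
by apply/eqP; field; rewrite gt_eqF.
Qed.

End dot_product.

(** * Projections onto column spans *)

Section column_span.
Context {R : realType} {n p : nat}.
Variable X : 'M[R]_(n, p).
Implicit Types (T : {set 'I_p}) (v : 'cV[R]_n).

Lemma colspan_lincomb T v : (v^T <= colspan X T)%MS ->
  exists c : 'I_p -> R, v = \sum_(k in T) c k *: col k X.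
Proof.
move=> /sub_sumsmxP[u vE].
have uE k : exists c : R, u k *m <<(col k X)^T>>%MS = c *: (col k X)^T.
  by apply/sub_rVP; rewrite (submx_trans (submxMl _ _))// genmxE.
exists (fun k => projT1 (cid (uE k))).
rewrite -[v]trmxK vE linear_sum/=; apply: eq_bigr => k _.
by case: cid => c /= ->; rewrite linearZ/= trmxK.
Qed.

Lemma orthproj_lincomb T v :
  exists c : 'I_p -> R, orthproj X T *m v = \sum_(k in T) c k *: col k X.
Proof. exact: colspan_lincomb (orthproj_in _ _ _). Qed.

Lemma mulmx_supp (b : 'cV[R]_p) :
  X *m b = \sum_(k in supp b) b k 0 *: col k X.
Proof.
apply/colP => i; rewrite mxE summxE (bigID (mem (supp b)))/=.
rewrite [X in _ + X]big1 ?addr0 => [|k].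
  by apply: eq_bigr => k _; rewrite !mxE mulrC.
by rewrite inE negbK => /eqP ->; rewrite mulr0.
Qed.

(* Pythagoras with the decomposition [(Pi m - m) + Pi e]. *)
Lemma orthproj_risk T (m e : 'cV[R]_n) (c : 'I_p -> R) (a b d : 'cV[R]_n) :
  a = \sum_(k in T) c k *: col k X ->
  b = orthproj X T *m (m + e) -> d = orthproj X T *m e ->
  dot (b - m) (b - m) <= dot (a - m) (a - m) + (2 * dot e d - dot d d).
Proof.
move=> aE bE dE.
have ort v w : (exists c : 'I_p -> R, w = \sum_(k in T) c k *: col k X) ->
    dot (v - orthproj X T *m v) w = 0.
  move=> [f ->]; rewrite dot_sumr big1// => k kT.
  by rewrite dotZr /dot orthproj_ortho// mxE mulr0.
have := orthproj_lincomb T m.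
have [q qE] : exists q, q = orthproj X T *m m by exists (orthproj X T *m m).
rewrite -qE => qs.
have := orthproj_lincomb T e; rewrite -dE => ds.
rewrite mulmxDr -qE -dE in bE.
have h1 : dot (m - q) q = 0 by rewrite qE ort -?qE.
have h2 : dot (m - q) d = 0 by rewrite qE ort.
have h3 : dot (m - q) a = 0 by rewrite qE ort//; exists c.
have h4 : dot (e - d) d = 0 by rewrite {1}dE ort.
rewrite -subr_ge0.
(* The slack is the squared distance from [a] to the projection [q] of [m]. The noise term equals
   [dot d d], but is kept in the shape bounded by [dot_le_oproj]. *)
suff -> : dot (a - m) (a - m) + (2 * dot e d - dot d d) - dot (b - m) (b - m)
    = dot (a - q) (a - q) by exact: dot_ge0.
move: h1 h2 h3 h4; rewrite bE !dotlin (dotC d q) (dotC d m) (dotC q m)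
  (dotC a m) (dotC a q).
move: (dot m q) (dot m d) (dot m a) (dot e d) (dot q q) (dot q d) (dot q a).
by move=> *; lra.
Qed.

End column_span.

(** * First-order optimality of the weights *)

Lemma slope_ge0 {R : realType} (D q : R) : 0 <= q ->
  (forall e, 0 < e -> e <= 1 -> 0 <= e * D + e ^+ 2 * q) -> 0 <= D.
Proof.
move=> q0 h; rewrite leNgt; apply/negP => D0.
have z0 : 0 < q + 1 - D by lra.
(* With this [e], [D + e * q = - e * (1 - D)], which is negative when [D] is. *)
pose e := - D / (q + 1 - D).
have e0 : 0 < e by rewrite divr_gt0// oppr_gt0.
have e1 : e <= 1 by rewrite ler_pdivrMr//; lra.
have ez : e * (q + 1 - D) = - D by rewrite divfK// gt_eqF.
have := h e e0 e1; rewrite expr2 -mulrA -mulrDr pmulr_rge0// => h1.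
have : 0 < e * (1 - D) by rewrite mulr_gt0//; lra.
lra.
Qed.

Section minimizer.
Context {R : realType} {n p : nat}.
Variables (X : 'M[R]_(n, p)) (y : 'cV[R]_n) (s2 : R) (F : {set {set 'I_p}}).
Implicit Types (th : 'rV[R]_#|F|) (z : 'cV[R]_n).

Let m (j : 'I_#|F|) := muhat X y j.
Let pen (j : 'I_#|F|) : R := 26 * s2 * ln (1 / weight (enum_val j)).
Let loss j := 2^-1 * dot (m j - y) (m j - y) + pen j.

Lemma mix_sqdist th z : simplex th ->
  \sum_j th 0 j * dot (m j - z) (m j - z)
    = \sum_j th 0 j * dot (m j) (m j) - 2 * dot (muhat_mix X y th) z + dot z z.
Proof.
move=> [th1 _].
rewrite [dot z z in RHS](_ : _ = \sum_j th 0 j * dot z z); last first.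
  by rewrite -mulr_suml th1 mul1r.
rewrite dot_suml mulr_sumr -sumrB -big_split/=; apply: eq_bigr => j _.
by rewrite !dotlin (dotC z); ring.
Qed.

(** The spread around the mixture is the mean of [|m j - y|^2] minus [|mixture - y|^2], so half of
    it cancels half of the fit. What remains is a convex quadratic plus a term linear in [th]. *)
Lemma HcritE th : simplex th ->
  Hcrit X y s2 th = 2^-1 * dot (muhat_mix X y th - y) (muhat_mix X y th - y)
                    + \sum_j th 0 j * loss j.
Proof.
move=> sth; rewrite /Hcrit sqr_l2norm.
under eq_bigr do rewrite sqr_l2norm -/(m _).
have -> : \sum_j th 0 j * loss j =
   2^-1 * \sum_j th 0 j * dot (m j - y) (m j - y) + \sum_j th 0 j * pen j.
  by rewrite mulr_sumr -big_split/=; apply: eq_bigr => j _; rewrite /loss; ring.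
have -> : \sum_j th 0 j * pen j =
    26 * s2 * \sum_j th 0 j * ln (1 / weight (enum_val j)).
  by rewrite mulr_sumr; apply: eq_bigr => j _; rewrite /pen; ring.
rewrite !mix_sqdist// !dotlin (dotC y).
by field.
Qed.

(** Moving from [th] towards vertex [k] by a step [e] changes the criterion by [e * D + e ^+ 2 * q],
    where [D] is the right-hand side and [q] is half the squared distance from [m k] to the
    mixture. *)
Lemma minimizer_first_order th k : Hminimizer X y s2 th ->
  0 <= dot (muhat_mix X y th - y) (m k - muhat_mix X y th)
       + loss k - \sum_j th 0 j * loss j.
Proof.
move=> [sth min]; case: (sth) => th1 th0.
set D := (X in 0 <= X).
apply: (@slope_ge0 _ _
  (2^-1 * dot (m k - muhat_mix X y th) (m k - muhat_mix X y th))).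
  by rewrite mulr_ge0 ?dot_ge0.
move=> e e0 e1; pose the : 'rV[R]_#|F| := (1 - e) *: th + e *: delta_mx 0 k.
(* A general module covers the total weight, the losses and the mixture vector at once. *)
have sumthe (V : lmodType R) (f : 'I_#|F| -> V) :
    \sum_j the 0 j *: f j = (1 - e) *: (\sum_j th 0 j *: f j) + e *: f k.
  rewrite scaler_sumr (bigD1 k)//= [in RHS](bigD1 k)//= !mxE !eqxx mulr1.
  rewrite [in LHS]scalerDl scalerA [LHS]addrAC; congr (_ + _ + _).
  apply: eq_bigr => j jk; rewrite !mxE eqxx/= (negbTE jk) mulr0 addr0.
  by rewrite scalerA.
have sthe : simplex the.
  split; last first.
    by move=> j; rewrite !mxE addr_ge0// mulr_ge0// ?subr_ge0// ?ler0n// ltW.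
  have := sumthe R^o (fun=> 1); rewrite /GRing.scale/=.
  under eq_bigr do rewrite mulr1; move=> ->.
  by under eq_bigr do rewrite mulr1; rewrite th1; ring.
have := min _ sthe; rewrite !HcritE//.
have := sumthe R^o loss; rewrite {1 2 3 4}/GRing.scale/= => ->.
have -> : muhat_mix X y the = (1 - e) *: muhat_mix X y th + e *: m k.
  exact: sumthe.
rewrite -subr_ge0 /D; set S := \sum_j _; set c := muhat_mix _ _ _.
move=> h; apply: le_trans h _; rewrite le_eqVlt; apply/orP; left; apply/eqP.
rewrite !dotlin (dotC c (m k)) (dotC y c) (dotC y (m k)).
by field.
Qed.

(** Once [y = mu + xi] is substituted, the two sides differ exactly by the quantity of
    [minimizer_first_order]. The negative squared distances will absorb the linear noise. *)
Lemma minimizer_oracle th k (mu xi : 'cV[R]_n) : y = mu + xi ->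
  Hminimizer X y s2 th ->
  dot (muhat_mix X y th - mu) (muhat_mix X y th - mu)
  <= dot (m k - mu) (m k - mu) + pen k
     + \sum_j th 0 j * (2 * dot xi (m j - m k)
                        - 2^-1 * dot (m j - m k) (m j - m k) - pen j).
Proof.
move=> yE mth; have [sth _] := mth; have := minimizer_first_order k mth.
set c := muhat_mix X y th; set q := \sum_j th 0 j * dot (m j) (m j).
have -> : \sum_j th 0 j * loss j =
   2^-1 * \sum_j th 0 j * dot (m j - y) (m j - y) + \sum_j th 0 j * pen j.
  by rewrite mulr_sumr -big_split/=; apply: eq_bigr => j _; rewrite /loss; ring.
have -> : \sum_j th 0 j * (2 * dot xi (m j - m k)
      - 2^-1 * dot (m j - m k) (m j - m k) - pen j) =
    2 * dot xi (c - m k)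
    - 2^-1 * \sum_j th 0 j * dot (m j - m k) (m j - m k)
    - \sum_j th 0 j * pen j.
  have -> : dot xi (c - m k) = \sum_j th 0 j * dot xi (m j - m k).
    rewrite dotDr dotNr dot_sumr -[dot xi (m k)]mul1r -(proj1 sth) mulr_suml.
    rewrite -sumrB; apply: eq_bigr => j _.
    by rewrite !dotlin -/(m j); ring.
  rewrite !mulr_sumr -!sumrB; apply: eq_bigr => j _; ring.
rewrite !mix_sqdist// -/c -/q /loss; set P := \sum_j _.
rewrite -subr_ge0 => h; rewrite -subr_ge0; apply: le_trans h _.
rewrite le_eqVlt; apply/orP; left; apply/eqP.
have -> : xi = y - mu by rewrite yE addrAC subrr add0r.
rewrite !dotlin (dotC y c) (dotC y (m k)) (dotC mu c) (dotC mu (m k)).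
by rewrite (dotC c (m k)); field.
Qed.

End minimizer.

(** * Weights of the supports *)

Section weights.
Context {R : realType} {p : nat}.
Implicit Type T : {set 'I_p}.

Let H : R := (expR 1 - expR (- p%:R)) / (expR 1 - 1).

Let e_gt1 : 1 < expR 1 :> R.
Proof. by rewrite expR_gt1. Qed.

Let eN_le1 : expR (- p%:R) <= 1 :> R.
Proof. by rewrite expR_le1 oppr_le0. Qed.

Let H_ge1 : 1 <= H.
Proof. by rewrite ler_pdivlMr ?subr_gt0// mul1r lerD2l lerN2. Qed.

Let H_gt0 : 0 < H.
Proof. exact: lt_le_trans H_ge1. Qed.

Let bin_card_gt0 T : 0 < 'C(p, #|T|)%:R :> R.
Proof. by rewrite ltr0n bin_gt0 -[leqRHS]card_ord max_card. Qed.

Let lnH_ge0 : 0 <= ln H.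
Proof. exact: ln_ge0. Qed.

Let lnH_le : ln H <= 2^-1.
Proof.
have -> : 2^-1 = ln (expR 2^-1) :> R by rewrite expRK.
rewrite ler_ln ?posrE ?expR_gt0// ler_pdivrMr ?subr_gt0//.
(* With [z = expR (1/2)] the claim reduces to [z <= z ^ 2 - 1], which holds once
   [z] exceeds the golden ratio. *)
have eE : expR 1 = expR 2^-1 ^+ 2 :> R.
  by rewrite -expRM_natl; congr expR; field.
(* [(1 + 1/16)^8] is about 1.6242, above the golden ratio; [(1 + 1/8)^4] would fall short. *)
have z16 : (1 + 16^-1) ^+ 8 <= expR 2^-1 :> R.
  have -> : 2^-1 = 8%:R * 16^-1 :> R by field.
  rewrite expRM_natl; apply: lerXn2r; rewrite ?nnegrE ?expR_ge0//.
  exact: expR_ge1Dx.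
have z_gt : 203 / 125 <= expR 2^-1 :> R by apply: le_trans z16; lra.
rewrite eE; set z := expR 2^-1 in z_gt *.
have : 0 <= expR (- p%:R) :> R by exact: expR_ge0.
(* The roots sum to 1, so the inner product is [z^2 - z] minus a constant slightly above 1. *)
have : 0 <= z * ((z - 203 / 125) * (z + 78 / 125)).
  by rewrite !mulr_ge0//; lra.
by nra.
Qed.

Lemma weight_gt0 T : 0 < weight T :> R.
Proof.
by rewrite /weight -/H invr_gt0 mulr_gt0 ?expR_gt0// mulr_gt0.
Qed.

(** Both the penalty of [T] in [Hcrit], up to [26 * s2], and the exponent that [T] costs in the
    union bound. *)
Definition lweight T : R := ln (1 / weight T).

Lemma weightE T : weight T = expR (- lweight T) :> R.
Proof.
rewrite /lweight ln_div ?posrE ?weight_gt0// ln1 sub0r opprK lnK//.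
by rewrite posrE weight_gt0.
Qed.

Lemma lweightE T : lweight T = ln H + ln 'C(p, #|T|)%:R + #|T|%:R.
Proof.
rewrite /lweight div1r /weight invrK -/H.
by rewrite !lnM ?posrE ?expRK ?expR_gt0// mulr_gt0.
Qed.

(** Lets the deviation level dominate the dimension of the span, as [subgaussian_sqr_tail]
    requires. *)
Lemma card_le_lweight T : #|T|%:R <= lweight T.
Proof.
rewrite lweightE lerDr addr_ge0// ln_ge0// ler1n bin_gt0.
by rewrite -[leqRHS]card_ord max_card.
Qed.

Lemma lweight_ge0 T : 0 <= lweight T.
Proof. exact: le_trans (card_le_lweight T). Qed.

(** [k^k / k!] is one term of the series of [expR k], and ['C(p, k) * k!] is a falling factorial, at
    most [p^k]. *)
Lemma bin_le_expR k : (0 < k <= p)%N ->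
  'C(p, k)%:R <= (expR 1 * p%:R / k%:R) ^+ k :> R.
Proof.
case: k => // k /andP[_ kp].
have fact0 : 0 < k.+1`!%:R :> R by rewrite ltr0n fact_gt0.
have h1 : k.+1%:R ^+ k.+1 <= expR 1 ^+ k.+1 * k.+1`!%:R :> R.
  rewrite -expRM_natr mul1r -ler_pdivrMr//.
  by apply: le_trans (expR_ge1Dxn k (ler0n R k.+1)); rewrite lerDr.
have h2 : 'C(p, k.+1)%:R * k.+1`!%:R <= p%:R ^+ k.+1 :> R.
  rewrite -natrM bin_ffact -natrX ler_nat.
  by elim: k.+1 => // m IH; rewrite ffactnSr expnSr leq_mul// leq_subr.
rewrite expr_div_n exprMn ler_pdivlMr ?exprn_gt0//.
rewrite -(ler_pM2r fact0).
have := ler_pM (mulr_ge0 (ler0n R 'C(p, k.+1)) (ler0n R k.+1`!))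
  (exprn_ge0 k.+1 (ler0n R k.+1)) h2 h1.
lra.
Qed.

(** The 24 pays for [48 * ln H], since [ln H <= 1/2]. For nonempty [T] the logarithm on the right is
    at least 1, so [ln 'C(p, #|T|)] and [#|T|] are each at most [#|T|] times it, whence 96 = 2 *
    48. *)
Lemma lweight_le T :
  48 * lweight T
  <= 24 + 96 * #|T|%:R * ln (expR 1 * p%:R / (maxn #|T| 1)%:R).
Proof.
have [T0|T0] := posnP #|T|.
  rewrite lweightE T0 mulr0 mul0r addr0 bin0 ln1 addr0; have := lnH_le; lra.
have Tp : (#|T| <= p)%N by rewrite -[leqRHS]card_ord max_card.
rewrite (maxn_idPl T0); set l := ln (expR 1 * _ / _).
have T0R : 0 < #|T|%:R :> R by rewrite ltr0n.
have pR : #|T|%:R <= p%:R :> R by rewrite ler_nat.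
have q0 : 0 < expR 1 * p%:R / #|T|%:R :> R.
  by rewrite divr_gt0// mulr_gt0 ?expR_gt0// (lt_le_trans T0R).
have l1 : 1 <= l.
  rewrite -[leLHS](@expRK R) ler_ln ?posrE ?expR_gt0//.
  by rewrite ler_pdivlMr// ler_pM2l ?expR_gt0.
have hC : ln 'C(p, #|T|)%:R <= #|T|%:R * l.
  have -> : #|T|%:R * l = ln ((expR 1 * p%:R / #|T|%:R) ^+ #|T|).
    by rewrite lnXn// mulr_natl.
  by rewrite ler_ln ?posrE ?exprn_gt0// bin_le_expR// T0.
have : #|T|%:R <= #|T|%:R * l by rewrite ler_peMr// ltW.
by have := lnH_le; rewrite lweightE; lra.
Qed.

(** Grouped by cardinality, the supports cancel the binomials and leave the geometric sum of
    [expR (- k)] for [k <= p], whose value is [H]. *)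
Lemma sum_weight : \sum_(T : {set 'I_p}) weight T = 1 :> R.
Proof.
have H0 : H != 0 by rewrite gt_eqF// (lt_le_trans ltr01).
pose f k : R := (H * 'C(p, k)%:R * expR k%:R)^-1.
rewrite (partition_big (fun T => inord #|T| : 'I_p.+1) predT)//=.
have -> : 1 = \sum_(k < p.+1) H^-1 * expR (-1) ^+ k :> R.
  rewrite -mulr_sumr.
  have e1 : 1 - expR (-1) != 0 :> R.
    by rewrite gt_eqF// subr_gt0 expR_lt1 ltrN10.
  have /(congr1 (fun z => z / (expR (-1) - 1))) := subrX1 (expR (-1) : R) p.+1.
  rewrite mulrAC divff ?mul1r; last by rewrite -oppr_eq0 opprB.
  move=> <-; rewrite -expRM_natl /H mulrN1 -natr1 opprD expRD.
  rewrite (expRN 1) (expRN p%:R); set a := expR 1; set b := expR p%:R.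
  have a1 : 1 < a by exact: e_gt1.
  have b1 : 1 <= b by rewrite -[leLHS]expR0 ler_expR.
  have ab1 : 1 < a * b.
    by rewrite (lt_le_trans a1)// ler_peMr// ltW// (lt_trans ltr01).
  by field; apply/and5P; split; [rewrite gt_eqF|rewrite lt_eqF|rewrite gt_eqF
    |rewrite gt_eqF|rewrite gt_eqF]; lra.
apply: eq_bigr => k _.
rewrite (eq_bigr (fun=> f k)) => [|T /eqP <-]; last first.
  by rewrite /f /weight inordK// ltnS -[leqRHS]card_ord max_card.
rewrite sumr_const.
have -> : #|(fun T : {set 'I_p} => inord #|T| == k)| = 'C(p, k).
  have := @card_draws 'I_p k; rewrite card_ord cardsE => <-.
  apply: eq_card => T. rewrite /in_mem/= -val_eqE/= inordK//.
  by rewrite ltnS -[leqRHS]card_ord max_card.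
rewrite /f -mulr_natr -expRM_natl mulrN1 expRN.
have C0 : 'C(p, k)%:R != 0 :> R by rewrite pnatr_eq0 -lt0n bin_gt0 -ltnS.
have e0 : expR k%:R != 0 :> R by rewrite gt_eqF ?expR_gt0.
by field; rewrite H0 e0 C0.
Qed.

End weights.

(** * Measurability of random vectors *)

Section measurable_vectors.
Context {R : realType} {d : measure_display} {Omega : measurableType d} {n : nat}.
Implicit Type f : Omega -> 'cV[R]_n.

Lemma measurable_colvecP f : measurable_fun [set: Omega] f <->
  forall i, measurable_fun [set: Omega] (fun w => f w i 0).
Proof.
split=> [mf i|mf].
- have mi : measurable_fun [set: 'cV[R]_n] (fun u : 'cV[R]_n => u i 0).
    move=> _ Y mY; rewrite setTI; apply: sub_sigma_algebra => /=.
    rewrite -bigcup_seq/=; exists i => /=; first by rewrite mem_index_enum.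
    by exists Y => //; rewrite setTI.
  exact: measurableT_comp mi mf.
(* The sets with measurable preimage form a sigma-algebra containing the coordinate generators. *)
- move=> _ B mB; pose G : set (set 'cV[R]_n) := [set B | measurable (f @^-1` B)].
  suff : (@measurable _ 'cV[R]_n) `<=` G by rewrite setTI; apply.
  apply: smallest_sub.
    split; first by rewrite /G/= preimage_set0; exact: measurable0.
      by move=> A GA; rewrite /G/= setTD preimage_setC; exact: measurableC.
    move=> A GA; rewrite /G/= preimage_bigcup.
    by apply: bigcup_measurable => k _; exact: GA.
  rewrite -bigcup_seq => A [i _ [Y mY <-]].
  by rewrite /G/= setTI -[X in measurable X]setTI; exact: mf.
Qed.

Lemma measurable_dot f v : measurable_fun [set: Omega] f ->
  measurable_fun [set: Omega] (fun w => dot v (f w)).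
Proof.
move=> /measurable_colvecP mf.
rewrite (_ : (fun _ => _) = fun w => \sum_i v i 0 * f w i 0); last first.
  by apply/funext => w; rewrite dotE.
by apply: measurable_sum => i; apply: measurable_funM.
Qed.

Lemma measurable_sum_sqr_dot f (s : seq 'cV[R]_n) :
  measurable_fun [set: Omega] f ->
  measurable_fun [set: Omega] (fun w => \sum_(u <- s) dot u (f w) ^+ 2).
Proof.
move=> mf; apply: measurable_sum => u; apply: measurable_funX.
exact: measurable_dot.
Qed.

End measurable_vectors.

(** * Two Gaussian integrals *)

Section normal_mixture.
Context {R : realType}.
Local Notation mu := (@lebesgue_measure R).
(** Standard deviation 4/5 makes [1 - (4/5)^2 = (3/5)^2] a square, so that [normal_exp_sqr_moment]
    is rational. *)
Local Notation phi := (normal_pdf (0 : R) (4 / 5)).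

Lemma normal_peakE (s : R) : 0 < s -> normal_peak s = s^-1 * normal_peak 1.
Proof.
move=> s0; rewrite /normal_peak -!mulrnAr sqrtrM ?sqr_ge0// sqrtr_sqr.
by rewrite gtr0_norm// invfM expr1n mul1r.
Qed.

Let n45 : (4 / 5 : R) != 0. Proof. by rewrite gt_eqF//; lra. Qed.
Let n43 : (4 / 3 : R) != 0. Proof. by rewrite gt_eqF//; lra. Qed.

(** Completing the square shifts the mean to [16/25 * t]. *)
Lemma normal_exp_moment (t : R) :
  (\int[mu]_s (phi s * expR (s * t))%:E = (expR (8 / 25 * t ^+ 2))%:E)%E.
Proof.
under eq_integral => s _.
  have -> : phi s * expR (s * t)
      = expR (8 / 25 * t ^+ 2) * normal_pdf (16 / 25 * t) (4 / 5) s.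
    rewrite !normal_pdfE//= -[LHS]mulrA [RHS]mulrCA; congr (_ * _).
    by rewrite /normal_fun -!expRD; congr expR; field.
  rewrite EFinM.
  over.
rewrite ge0_integralZl_EFin//=.
- by rewrite integral_normal_pdf mule1.
- by move=> s _; rewrite lee_fin normal_pdf_ge0.
- by apply/measurable_EFinP; exact: measurable_normal_pdf.
Qed.

(** The tilt changes the deviation from 4/5 to 4/3, and 5/3 is the ratio of the two. *)
Lemma normal_exp_sqr_moment :
  (\int[mu]_s (phi s * expR (s ^+ 2 / 2))%:E = (5 / 3)%:E)%E.
Proof.
under eq_integral => s _.
  have -> : phi s * expR (s ^+ 2 / 2) = 5 / 3 * normal_pdf 0 (4 / 3) s.
    rewrite !normal_pdfE//= (normal_peakE (_ : 0 < 4 / 5)); last lra.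
    rewrite (normal_peakE (_ : 0 < 4 / 3)); last lra.
    have -> : normal_fun 0 (4 / 3) s =
        normal_fun 0 (4 / 5) s * expR (s ^+ 2 / 2).
      by rewrite /normal_fun -expRD; congr expR; field.
    by field.
  rewrite EFinM.
  over.
rewrite ge0_integralZl_EFin//=.
- by rewrite integral_normal_pdf mule1.
- by move=> s _; rewrite lee_fin normal_pdf_ge0.
- by apply/measurable_EFinP; exact: measurable_normal_pdf.
Qed.

End normal_mixture.

(** * Sub-Gaussian quadratic forms *)

Section subgaussian.
Context {R : realType} {d : measure_display} {Omega : measurableType d}.
Context (P : probability Omega R) {n : nat} (sigma : R) (xi : Omega -> 'cV[R]_n).
Hypothesis sigma_gt0 : 0 < sigma.
Hypothesis xi_meas : measurable_fun [set: Omega] xi.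
Hypothesis xi_subgauss : forall v : 'cV[R]_n,
  (\int[P]_w (expR (dot v (xi w)))%:E
     <= (expR (sigma ^+ 2 * dot v v / 2))%:E)%E.

Local Notation mu := (@lebesgue_measure R).
Local Notation phi := (normal_pdf (0 : R) (4 / 5)).

(** The free vector [v] lets the induction on [s] absorb the linear term that replaces each
    square. *)
Let Z (s : seq 'cV[R]_n) v w : R :=
  8 / 25 * ((\sum_(u <- s) dot u (xi w) ^+ 2) / sigma ^+ 2) + dot v (xi w).

Let measurable_Z s v : measurable_fun [set: Omega] (Z s v).
Proof.
apply: measurable_funD; last exact: measurable_dot.
by do 2 apply: measurable_funM => //; exact: measurable_sum_sqr_dot.
Qed.

(* [exp (8/25 t^2)] is the moment generating function at [t] of a centred normal
   variable of variance 16/25, so each squared coordinate can be traded for a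
   random linear term, to which the sub-Gaussian hypothesis applies. *)
Lemma subgaussian_sqr_moment (s : seq 'cV[R]_n) v : orthonormal_seq s ->
  (forall u, u \in s -> dot v u = 0) ->
  (\int[P]_w (expR (Z s v w))%:E
     <= ((5 / 3) ^+ size s * expR (sigma ^+ 2 * dot v v / 2))%:E)%E.
Proof.
have s0 : sigma != 0 by rewrite gt_eqF.
elim: s v => [|a s IH] v /=.
  move=> _ _; rewrite expr0 mul1r.
  under eq_integral do rewrite /Z big_nil mul0r mulr0 add0r.
  exact: xi_subgauss.
move=> [aa as0 os] vs.
have va : dot v a = 0 by apply: vs; rewrite mem_head.
pose f (z : Omega * R) : \bar R :=
  (phi z.2 * expR (Z s (v + (z.2 / sigma) *: a) z.1))%:E.
have ZE t w : Z s (v + (t / sigma) *: a) w = t * (dot a (xi w) / sigma) + Z s v w.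
  by rewrite /Z dotDl dotZl; ring.
have mf : measurable_fun [set: Omega * R] f.
  apply/measurable_EFinP; apply: measurable_funM.
    by apply: measurableT_comp; [exact: measurable_normal_pdf|].
  apply: measurableT_comp => //.
  under eq_fun do rewrite ZE.
  apply: measurable_funD.
    apply: measurable_funM => //; apply: measurable_funM => //.
    apply: (measurableT_comp (f := fun w => dot a (xi w))) => //.
    exact: measurable_dot.
  exact: (measurableT_comp (f := Z s v)).
have f0 z : (0 <= f z)%E by rewrite lee_fin mulr_ge0 ?normal_pdf_ge0 ?expR_ge0.
have -> : (\int[P]_w (expR (Z (a :: s) v w))%:E = \int[P]_w \int[mu]_t f (w, t))%E.
  apply: eq_integral => w _.
  have -> : Z (a :: s) v w = 8 / 25 * (dot a (xi w) / sigma) ^+ 2 + Z s v w.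
    by rewrite /Z big_cons; field.
  transitivity (\int[mu]_t ((phi t * expR (t * (dot a (xi w) / sigma)))%:E
                             * (expR (Z s v w))%:E))%E.
    rewrite ge0_integralZr.
    - by rewrite normal_exp_moment -EFinM -expRD.
    - exact: measurableT.
    - apply/measurable_EFinP; apply: measurable_funM.
        exact: measurable_normal_pdf.
      by apply: measurableT_comp => //; exact: measurable_funM.
    - by move=> t _; rewrite lee_fin mulr_ge0 ?normal_pdf_ge0 ?expR_ge0.
    - by rewrite lee_fin expR_ge0.
  by apply: eq_integral => t _; rewrite /f ZE [in RHS]expRD -EFinM [in RHS]mulrA.
(* After the swap, [t] is fixed and the induction hypothesis applies at [v + (t / sigma) *: a],
   still orthogonal to [s]. *)
rewrite (fubini_tonelli (m1 := P) (m2 := mu))//.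
pose C : R := (5 / 3) ^+ size s * expR (sigma ^+ 2 * dot v v / 2).
have C0 : 0 <= C by rewrite mulr_ge0 ?expR_ge0// exprn_ge0//; lra.
have -> : (5 / 3) ^+ (size s).+1 * expR (sigma ^+ 2 * dot v v / 2) = C * (5 / 3).
  by rewrite exprS /C; ring.
rewrite EFinM -normal_exp_sqr_moment.
have mphi : measurable_fun [set: R]
    (fun t => (phi t * expR (t ^+ 2 / 2))%:E).
  apply/measurable_EFinP; apply: measurable_funM.
    exact: measurable_normal_pdf.
  by apply: measurableT_comp => //; apply: measurable_funM.
rewrite -ge0_integralZl_EFin//=; last first.
  by move=> t _; rewrite lee_fin mulr_ge0 ?normal_pdf_ge0 ?expR_ge0.
apply: ge0_le_integral => //.
- by move=> t _; apply: integral_ge0.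
- exact: measurable_fun_fubini_tonelli_G.
- by apply: emeasurable_funM.
move=> t _; rewrite /f/=.
under eq_integral do rewrite EFinM.
rewrite ge0_integralZl_EFin//=; first last.
- exact: normal_pdf_ge0.
- by apply/measurable_EFinP; apply: measurableT_comp => //; exact: measurable_Z.
apply: (@le_trans _ _ ((phi t)%:E * ((5 / 3) ^+ size s *
    expR (sigma ^+ 2 * dot (v + (t / sigma) *: a) (v + (t / sigma) *: a) / 2))%:E)%E).
  rewrite lee_wpmul2l ?lee_fin ?normal_pdf_ge0//; apply: IH => // u us.
  by rewrite dotDl dotZl vs ?as0 ?mulr0 ?addr0// inE us orbT.
rewrite -!EFinM lee_fin le_eqVlt; apply/orP; left; apply/eqP.
(* [a] is a unit vector orthogonal to [v], so the new linear term costs [expR (t ^+ 2 / 2)], which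
   [phi] integrates to the extra 5/3. *)
have -> : sigma ^+ 2 * dot (v + (t / sigma) *: a) (v + (t / sigma) *: a) / 2 =
    sigma ^+ 2 * dot v v / 2 + t ^+ 2 / 2.
  by rewrite !dotlin (dotC a) va aa; field.
by rewrite expRD /C; ring.
Qed.

(** Chernoff bound from the moment at [v = 0]: the event costs [expR (- (48/25 * t))], while
    [(5/3) ^+ size s <= expR (2/3 * t)], and 48/25 - 2/3 exceeds 1. *)
Lemma subgaussian_sqr_tail (s : seq 'cV[R]_n) (t : R) : orthonormal_seq s ->
  (size s)%:R <= t ->
  (P [set w | (6 * sigma ^+ 2 * t < \sum_(u <- s) dot u (xi w) ^+ 2)%R]
     <= (expR (- t))%:E)%E.
Proof.
move=> os st; have s20 : 0 < sigma ^+ 2 by rewrite exprn_gt0.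
set A := [set w | _]; pose a := expR (48 / 25 * t).
have mS := measurable_sum_sqr_dot s xi_meas.
have mA : measurable A.
  by rewrite -[A]setTI; exact: measurable_fun_ltr.
have dot0 (u : 'cV[R]_n) : dot 0 u = 0 by rewrite dotC dot0r.
have := subgaussian_sqr_moment os (fun u _ => dot0 u).
rewrite dot0 mulr0 mul0r expR0 mulr1.
under eq_integral do rewrite /Z dot0 addr0.
move=> M.
have le1 : (a%:E * P A <= ((5 / 3) ^+ size s)%:E)%E.
  apply: le_trans M.
  rewrite -[X in P X]setIT -integral_indic// -ge0_integralZl_EFin//=; last first.
  - exact: expR_ge0.
  - by apply/measurable_EFinP; exact: measurable_indic.
  apply: ge0_le_integral => //=.
  - by move=> w _; rewrite -EFinM lee_fin mulr_ge0 ?expR_ge0.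
  - by apply: emeasurable_funM => //; apply/measurable_EFinP; exact: measurable_indic.
  - apply/measurable_EFinP; apply: measurableT_comp => //.
    by do 2 apply: measurable_funM => //.
  move=> w _; rewrite -EFinM lee_fin indicE.
  have [|] := boolP (w \in A); last by rewrite mulr0 expR_ge0.
  rewrite inE mulr1 ler_expR /A/= => /ltW h.
  by rewrite mulrA ler_pdivlMr//; lra.
have a0 : 0 < a by exact: expR_gt0.
have -> : P A = (a^-1%:E * (a%:E * P A))%E.
  by rewrite muleA -EFinM mulVf ?gt_eqF// mul1e.
apply: le_trans (_ : a^-1%:E * ((5 / 3) ^+ size s)%:E <= _)%E.
  by rewrite lee_wpmul2l// lee_fin invr_ge0 ltW.
rewrite -EFinM lee_fin /a -expRN.
apply: le_trans (_ : expR (- (48 / 25 * t)) * expR ((size s)%:R * (2 / 3)) <= _).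
  rewrite ler_wpM2l ?expR_ge0// expRM_natl.
  apply: lerXn2r; rewrite ?nnegrE ?expR_ge0//.
  by apply: le_trans (expR_ge1Dx _); lra.
have : 0 <= t by apply: le_trans st.
by rewrite -expRD ler_expR; lra.
Qed.

End subgaussian.

(** * Deterministic oracle inequality *)

Section oracle.
Context {R : realType} {n p : nat}.
Variable X : 'M[R]_(n, p).

(** Gram-Schmidt on the columns indexed by [S :|: T]. The family does not depend on the data, so the
    tail bound applies to it. *)
Lemma colspan_basis (S T : {set 'I_p}) : exists s : seq 'cV[R]_n,
  [/\ (size s <= #|S| + #|T|)%N, orthonormal_seq s,
      forall v, oproj s (orthproj X S *m v) = orthproj X S *m v
    & forall v, oproj s (orthproj X T *m v) = orthproj X T *m v].
Proof.
have [s [sz os cs]] := gram_schmidt [seq col k X | k <- enum (S :|: T)].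
exists s; split => //.
- by rewrite (leq_trans sz)// size_map -cardE leq_card_setU.
- move=> v; have [c ->] := orthproj_lincomb X S v.
  rewrite oproj_sum; apply: eq_bigr => k kS; rewrite oprojZ cs//.
  by apply: map_f; rewrite mem_enum inE kS.
- move=> v; have [c ->] := orthproj_lincomb X T v.
  rewrite oproj_sum; apply: eq_bigr => k kT; rewrite oprojZ cs//.
  by apply: map_f; rewrite mem_enum inE kT orbT.
Qed.

(** [dot_le_oproj] with [a = 1] and with [a = 1/2]; the factor is 1 + 2 = 3. *)
Lemma noise_le (s : seq 'cV[R]_n) (e b1 b2 dT : 'cV[R]_n) : orthonormal_seq s ->
  oproj s b1 = b1 -> oproj s b2 = b2 -> oproj s dT = dT ->
  (2 * dot e dT - dot dT dT)
    + (2 * dot e (b1 - b2) - 2^-1 * dot (b1 - b2) (b1 - b2))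
  <= 3 * \sum_(u <- s) dot u e ^+ 2.
Proof.
move=> os s1 s2 sd; rewrite -dot_oprojE//.
have h2 : (0 : R) < 2^-1 by [].
have := dot_le_oproj e ltr01 os sd.
have := @dot_le_oproj _ _ s _ e (b1 - b2) h2 os.
by rewrite oprojB s1 s2 => /(_ erefl); rewrite invrK invr1; lra.
Qed.

(** The noise costs 3 * 6 = 18 times [sigma ^+ 2 * (lweight S + lweight T + x)]. As
    [sigma ^+ 2 <= s2], the penalty 26 of [S] absorbs its share; [T] is charged 26 + 18 <= 48, and
    [x] 18 <= 22. *)
Lemma aggregate_risk (sigma s2 x : R) (mu xi : 'cV[R]_n) (F : {set {set 'I_p}})
    (th : 'rV[R]_#|F|) (B : {set 'I_p} -> {set 'I_p} -> seq 'cV[R]_n)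
    (b : 'cV[R]_p) :
  0 <= x -> sigma ^+ 2 <= s2 ->
  (forall S T, [/\ orthonormal_seq (B S T),
      forall v, oproj (B S T) (orthproj X S *m v) = orthproj X S *m v
    & forall v, oproj (B S T) (orthproj X T *m v) = orthproj X T *m v]) ->
  (forall S T, \sum_(u <- B S T) dot u xi ^+ 2
     <= 6 * sigma ^+ 2 * (lweight S + lweight T + x)) ->
  Hminimizer X (mu + xi) s2 th -> supp b \in F ->
  let m := muhat_mix X (mu + xi) th in
  (dot (m - mu) (m - mu)
   <= dot (X *m b - mu) (X *m b - mu)
     + s2 * (24 + 96 * #|supp b|%:R
             * ln (expR 1 * p%:R / (maxn #|supp b| 1)%:R))
     + 22 * sigma ^+ 2 * x)%R.
Proof.
move=> x0 s2s hB good mth TF; cbv zeta.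
set T := supp b in TF *.
pose k : 'I_#|F| := enum_rank_in TF T.
have kE : enum_val k = T by rewrite enum_rankK_in.
have [[th1 th0] _] := mth.
have := minimizer_oracle k erefl mth.
set m := muhat_mix _ _ _.
have := orthproj_risk (mulmx_supp X b) (erefl (orthproj X T *m (mu + xi))) erefl.
rewrite {4}/muhat kE.
have muhatk : muhat X (mu + xi) k = orthproj X T *m (mu + xi) by rewrite /muhat kE.
rewrite !muhatk -/(lweight T).
set bT := orthproj X T *m (mu + xi); set dT := orthproj X T *m xi.
set r := 2 * dot xi dT - dot dT dT => h1.
set sumj := \sum_j _ => h2.
have LT0 : 0 <= lweight T :> R := lweight_ge0 T.
have s20 : 0 <= sigma ^+ 2 by rewrite sqr_ge0.
(* The excess [r] of the risk of [T] is spread over the average, so that [noise_le] treats both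
   noise terms together. *)
have hsum : sumj <= 18 * sigma ^+ 2 * (lweight T + x) - r.
  rewrite [leRHS](_ : _ = \sum_j th 0 j * (18 * sigma ^+ 2 * (lweight T + x) - r));
    last by rewrite -mulr_suml th1 mul1r.
  apply: ler_sum => j _.
  apply: ler_wpM2l => //; rewrite -/(lweight (enum_val j)).
  set S := enum_val j; have [oB BS BT] := hB S T.
  have := noise_le xi oB (BS (mu + xi)) (BT (mu + xi)) (BT xi).
  rewrite -/bT -/dT -/r -/(muhat X (mu + xi) j).
  have := good S T; have LS0 : 0 <= lweight S :> R := lweight_ge0 S.
  have : 0 <= (s2 - sigma ^+ 2) * lweight S by rewrite mulr_ge0// subr_ge0.
  have : 0 <= sigma ^+ 2 * lweight S by rewrite mulr_ge0.
  by move: (sigma ^+ 2) => q; lra.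
have h3 : 0 <= (s2 - sigma ^+ 2) * lweight T by rewrite mulr_ge0// subr_ge0.
have h4 : 0 <= s2 * (24 + 96 * #|T|%:R * ln (expR 1 * p%:R / (maxn #|T| 1)%:R)
    - 48 * lweight T).
  by rewrite mulr_ge0 ?subr_ge0 ?lweight_le// (le_trans s20).
have h5 : 0 <= sigma ^+ 2 * x by rewrite mulr_ge0.
have h6 : 0 <= s2 * lweight T by rewrite mulr_ge0// (le_trans s20).
move: h4; rewrite mulrBr; set pe := s2 * (24 + _).
move: h1 h2 hsum h3 h5 h6; move: (sigma ^+ 2) => q.
by lra.
Qed.

End oracle.

(** * Union bound and conclusion *)

Lemma measure_bigsetU_le d (T : measurableType d) (R : realType)
    (P : {measure set T -> \bar R}) (I : Type) (r : seq I) (F : I -> set T) :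
  (forall i, measurable (F i)) ->
  (P (\big[setU/set0]_(i <- r) F i) <= \sum_(i <- r) P (F i))%E.
Proof.
move=> mF; elim: r => [|i r IH]; first by rewrite !big_nil measure0.
rewrite !big_cons (le_trans (measureU2 _ _ _))//; last by rewrite leeD2l.
exact: bigsetU_measurable.
Qed.

Theorem corollary1 (R : realType) (d : measure_display) (Omega : measurableType d)
  (P : probability Omega R) (n p : nat) (sigma : R) (mu : 'cV[R]_n)
  (X : 'M[R]_(n, p)) (xi : Omega -> 'cV[R]_n)
  (I : Type) (J : 'cV[R]_n -> set I) (bhat : I -> 'cV[R]_n -> 'cV[R]_p)
  (s2hat : 'cV[R]_n -> R)
  (thetahat : forall y : 'cV[R]_n, 'rV[R]_#|supports J bhat y|)
  (n_gt0 : (0 < n)%N) (p_gt0 : (0 < p)%N) (sigma_gt0 : 0 < sigma)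
  (xi_meas : measurable_fun [set: Omega] xi)
  (xi_subgauss : forall v : 'cV[R]_n,
     ('E_P[fun w => expR ((v^T *m xi w) 0 0)%R]
        <= (expR (sigma ^+ 2 * l2norm v ^+ 2 / 2)%R)%:E)%E)
  (J_neq0 : forall y, J y !=set0)
  (J_meas : forall j, measurable [set y | J y j])
  (bhat_meas : forall j, measurable_fun [set y | J y j] (bhat j))
  (s2hat_meas : measurable_fun [set: 'cV[R]_n] s2hat)
  (s2hat_ge0 : forall y, 0 <= s2hat y)
  (thetahat_min : forall y, Hminimizer X y (s2hat y) (thetahat y)) :
  let y := fun w : Omega => mu + xi w in
  let delta := P [set w | s2hat (y w) < sigma ^+ 2] in
  let muQ := fun w : Omega => muhat_mix X (y w) (thetahat (y w)) in
  forall x : R, 0 < x ->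
  prob_gt P (1 - delta - (2 * expR (- x))%R%:E)%E
    [set w | scaled_sqnorm (muQ w - mu) <=
       inf [set scaled_sqnorm (X *m bhat j (y w) - mu)
              + s2hat (y w) / n%:R
                * (24 + 96 * #|supp (bhat j (y w))|%:R
                   * ln (expR 1 * p%:R
                         / (maxn #|supp (bhat j (y w))| 1)%:R))
           | j in J (y w)]
       + 22 * sigma ^+ 2 * x / n%:R].
Proof.
move=> y delta muQ x x0.
have [B hB] : {B : {set 'I_p} -> {set 'I_p} -> seq 'cV[R]_n & forall S T,
    [/\ (size (B S T) <= #|S| + #|T|)%N, orthonormal_seq (B S T),
      forall v, oproj (B S T) (orthproj X S *m v) = orthproj X S *m v
    & forall v, oproj (B S T) (orthproj X T *m v) = orthproj X T *m v]}.
  exists (fun S T => projT1 (cid (colspan_basis X S T))) => S T.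
  by case: cid.
pose bad (ST : {set 'I_p} * {set 'I_p}) : set Omega :=
  [set w | 6 * sigma ^+ 2 * (lweight ST.1 + lweight ST.2 + x)
           < \sum_(u <- B ST.1 ST.2) dot u (xi w) ^+ 2].
pose lowvar := [set w | s2hat (y w) < sigma ^+ 2].
pose anybad := \big[setU/set0]_ST bad ST.
have y_meas : measurable_fun [set: Omega] y.
  apply/measurable_colvecP => i; under eq_fun do rewrite /y mxE.
  by apply: measurable_funD => //; exact: (measurable_colvecP _).1.
have mlow : measurable lowvar.
  rewrite -[lowvar]setTI; apply: measurable_fun_ltr => //.
  exact: measurableT_comp s2hat_meas y_meas.
have mbad ST : measurable (bad ST).
  rewrite -[bad _]setTI; apply: measurable_fun_ltr => //.
  exact: measurable_sum_sqr_dot.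
have manybad : measurable anybad by exact: bigsetU_measurable.
have subg v : (\int[P]_w (expR (dot v (xi w)))%:E
    <= (expR (sigma ^+ 2 * dot v v / 2))%:E)%E.
  by have := xi_subgauss v; rewrite unlock sqr_l2norm.
have Pbad ST : (P (bad ST) <= (weight ST.1 * weight ST.2 * expR (- x))%:E)%E.
  have [sz os _ _] := hB ST.1 ST.2.
  (* The bound becomes [expR (- t)] at the very level [t] used in [bad ST]. *)
  rewrite !weightE -!expRD -!opprD.
  apply: (subgaussian_sqr_tail sigma_gt0 xi_meas subg os).
  apply: (@le_trans _ _ (#|ST.1| + #|ST.2|)%:R); first by rewrite ler_nat.
  rewrite natrD -[leLHS]addr0 lerD ?(ltW x0)// lerD//; exact: card_le_lweight.
have Pany : (P anybad <= (expR (- x))%:E)%E.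
  apply: (le_trans (measure_bigsetU_le P _ mbad)).
  apply: (le_trans (lee_sum _ (fun ST _ => Pbad ST))).
  rewrite sumEFin lee_fin -mulr_suml.
  rewrite -(pair_bigA _ (fun S T => weight S * weight T))/=.
  by rewrite -big_distrlr/= !sum_weight !mul1r.
(* Off this union every pair of supports is good, so [aggregate_risk] holds for all [j]
   simultaneously. *)
exists (~` (lowvar `|` anybad)); split.
- by apply: measurableC; exact: measurableU.
- move=> w; rewrite setCU => -[/negP]; rewrite -leNgt => s2w nbad.
  rewrite /= -lerBlDr; apply: lb_le_inf.
    by have [j Jj] := J_neq0 (y w); eexists; exists j.
  move=> _ [j Jj <-]; rewrite lerBlDr.
  have good S T : \sum_(u <- B S T) dot u (xi w) ^+ 2
      <= 6 * sigma ^+ 2 * (lweight S + lweight T + x).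
    rewrite leNgt; apply/negP => h; apply: nbad.
    rewrite /anybad -bigcup_seq; exists (S, T) => //=.
    by rewrite mem_index_enum.
  have TF : supp (bhat j (y w)) \in supports J bhat (y w).
    by rewrite inE; apply/asboolP; exists j.
  have hB' S T : [/\ orthonormal_seq (B S T),
      forall v, oproj (B S T) (orthproj X S *m v) = orthproj X S *m v
    & forall v, oproj (B S T) (orthproj X T *m v) = orthproj X T *m v].
    by have [] := hB S T.
  have := aggregate_risk (ltW x0) s2w hB' good (thetahat_min (y w)) TF.
  rewrite -/(y w) -/(muQ w) /scaled_sqnorm !sqr_l2norm.
  have n0 : 0 <= n%:R^-1 :> R by rewrite invr_ge0.
  move=> /(ler_wpM2l n0) h; apply: (le_trans h).
  by rewrite le_eqVlt; apply/orP; left; apply/eqP; ring.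
- have fP (A : set Omega) : measurable A -> P A \is a fin_num.
    exact: fin_num_measure.
  have mU : measurable (lowvar `|` anybad) by exact: measurableU.
  rewrite probability_setC//.
  have : (P (lowvar `|` anybad) <= P lowvar + P anybad)%E by exact: measureU2.
  rewrite /delta -/lowvar; move: Pany (fP _ mlow) (fP _ manybad) (fP _ mU).
  case: (P lowvar) => // q; case: (P anybad) => // r; case: (P (_ `|` _)) => // t.
  rewrite -EFinD !lee_fin -!EFinB lte_fin => h1 _ _ _ h2.
  (* The union bound spends one [expR (- x)]; the second makes the inequality strict. *)
  by have := expR_gt0 (- x); lra.
Qed.
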